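(* Let $\Delta=\bigsqcup_{i\in\mathbb Z}\Delta(i)$ be a $\mathbb Z$-grading of an irreducible reduced crystallographic root system with compatible positive system and simple roots $\Pi$. Let $I$ be a lower ideal of $\Delta(1)$ and $\gamma\in\Delta(1)$. Then $\gamma$ is a maximal element of $I$ (with respect to $\preccurlyeq$) if and only if $w_{I,\min}(\gamma)\in-\Pi$.
   Context: A $\mathbb Z$-grading: $\Delta=\bigsqcup_i\Delta(i)$ with $\gamma_1+\gamma_2\in\Delta(i_1+i_2)$ whenever $\gamma_j\in\Delta(i_j)$ and $\gamma_1+\gamma_2\in\Delta$; compatibility: $\Delta^+=\Delta(0)^+\sqcup\bigsqcup_{i\ge1}\Delta(i)$ with $\Delta(0)^+$ a positive system of $\Delta(0)$. Order: $\mu\preccurlyeq\gamma$ iff $\gamma-\mu$ is a nonnegative integer combination of simple roots; lower ideals of $\Delta(1)$ are its downward closed subsets. $N(w)=\{\gamma\in\Delta^+\mid w(\gamma)\in-\Delta^+\}$. For $J\subset\Delta^+$: $J^1=J$, $J^k=(J+J^{k-1})\cap\Delta$, $\langle J\rangle=\bigcup_{k\ge1}J^k$. $w_{I,\min}$ is the unique element $w$ of the Weyl group with $N(w)=\langle I\rangle$. *)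

(* Defs.v *)
From HB Require Import structures.
From mathcomp Require Import all_boot all_order all_algebra finmap.
Set Implicit Arguments.
Unset Strict Implicit.
Unset Printing Implicit Defensive.
Import Order.TTheory GRing.Theory Num.Theory.
Local Open Scope ring_scope.

Section RootSystem.
Variables (R : realFieldType) (V : vectType R) (form : {dot V for idfun}).
Local Notation "''[' u , v ]" := (form u%R v%R) : ring_scope.
Implicit Types (a b x v : V) (Delta Psi P Pi I J : {fset V}).

Definition cartan a b : R := 2 * '[b, a] / '[a, a].

Definition refl a v : V := v - cartan a v *: a.

Fact refl_is_linear a : linear (refl a).
Proof.
move=> k u v; rewrite /refl /cartan linearPl /= mulrDr mulrDl mulrCA -!mulrA.
by rewrite scalerDl -scalerA scalerBr opprD addrACA.
Qed.
HB.instance Definition _ a :=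
  GRing.isLinear.Build R V V *:%R (refl a) (refl_is_linear a).

Record reduced_root_system Delta : Prop := ReducedRootSystem {
  root_span : <<Delta>>%VS = fullv;
  root_neq0 : 0 \notin Delta;
  root_refl : {in Delta &, forall a b, refl a b \in Delta};
  root_crystal : {in Delta &, forall a b, exists m : int, cartan a b = m%:~R};
  root_reduced : {in Delta, forall a (c : R), c *: a \in Delta ->
                                        c = 1 \/ c = - 1} }.

Definition irreducible_root_system Delta : Prop :=
  Delta <> fset0 /\
  forall A B, Delta = (A `|` B)%fset ->
    (forall a b, a \in A -> b \in B -> '[a, b] = 0) ->
    A = fset0 \/ B = fset0.

(* Psi need not span V: this is also applied to the degree 0 part of Delta. *)
Definition positive_system Psi P : Prop :=
  exists v, {in Psi, forall a, '[v, a] != 0} /\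
            P = [fset a in Psi | 0 < '[v, a]]%fset.

(* Simple roots are the positive roots not decomposable as a sum of two
   positive roots. *)
Definition simple_roots P : {fset V} :=
  [fset a in P | a \notin [fset (b + c)%R | b in P, c in P]]%fset.

Definition root_le Pi (mu gamma : V) : Prop :=
  exists c : V -> nat, gamma - mu = \sum_(a <- Pi) a *+ c a.

Record Zgrading Delta (D : int -> {fset V}) : Prop := ZGrading {
  grading_cover : forall a, a \in Delta <-> exists i, a \in D i;
  grading_disjoint : forall i j, i != j -> [disjoint D i & D j]%fset;
  grading_add : forall i j a b, a \in D i -> b \in D j ->
                  a + b \in Delta -> a + b \in D (i + j) }.

(* The union of P0 and of the D i for i >= 1 is disjoint since P0 is a subset
   of D 0. *)
Definition compatible_grading (D : int -> {fset V}) P : Prop :=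
  exists P0, positive_system (D 0) P0 /\
    forall a, a \in P <-> a \in P0 \/ exists2 i : int, 1 <= i & a \in D i.

Definition lower_ideal (le : V -> V -> Prop) (S I : {fset V}) : Prop :=
  (I `<=` S)%fset /\
  forall mu gamma, gamma \in I -> mu \in S -> le mu gamma -> mu \in I.

Definition maximal_in (le : V -> V -> Prop) (I : {fset V}) (gamma : V) : Prop :=
  gamma \in I /\ forall mu, mu \in I -> le gamma mu -> mu = gamma.

(* Since reflections are involutions, products of reflections already form a
   group. *)
Inductive weyl_group Delta : 'End(V) -> Prop :=
| weyl_id : weyl_group Delta \1%VF
| weyl_mul a w : a \in Delta -> weyl_group Delta w ->
    weyl_group Delta (linfun (refl a) \o w)%VF.

Definition inversion_set P (w : 'End(V)) : {fset V} :=
  [fset a in P | - w a \in P]%fset.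

(* J^k for k >= 1; the value at k = 0 is never used. *)
Fixpoint sum_pow Delta J (k : nat) : {fset V} :=
  match k with
  | 0 => fset0
  | 1 => J
  | k'.+1 => ([fset (a + b)%R | a in J, b in sum_pow Delta J k'] `&` Delta)%fset
  end.

Definition sum_closure Delta J (a : V) : Prop :=
  exists2 k : nat, (1 <= k)%N & a \in sum_pow Delta J k.

(* w is the element w_{I,min}: a Weyl group element is determined by its
   inversion set, so at most one w satisfies this. *)
Definition is_w_min Delta P I (w : 'End(V)) : Prop :=
  weyl_group Delta w /\
  forall a, a \in inversion_set P w <-> sum_closure Delta I a.

End RootSystem.

(* Main.v *)
Require Import Defs.
From HB Require Import structures.
From mathcomp Require Import all_boot all_order all_algebra finmap zify ring lra.
Set Implicit Arguments.
Unset Strict Implicit.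
Unset Printing Implicit Defensive.
Import Order.TTheory GRing.Theory Num.Theory.
Local Open Scope ring_scope.

(** Let N = <I> be the inversion set of w = w_{I,min}; its elements have degree
    at least 1, so w keeps positive roots of degree 0 positive.
    If - w gamma is simple and gamma < mu in I, then mu - gamma is a sum of
    simple roots of degree 0, so - w gamma = - w mu + w (mu - gamma) is a sum
    of at least two positive roots, which is impossible.
    Conversely, if gamma is maximal and - w gamma is a sum of two positive
    roots, then pulling back by w gives gamma + eta in N for some positive root
    eta not in N (both pulled back roots being positive would put them in N and
    force gamma to have degree at least 2). A descent on the k such that
    gamma + eta is in I^k rules this out. *)

(** * Inner products and reflections *)

Section Form.
Variables (R : realFieldType) (V : vectType R) (form : {dot V for idfun}).
Local Notation "''[' u , v ]" := (form u%R v%R) : ring_scope.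

Lemma dotC (u v : V) : '[u, v] = '[v, u].
Proof. by rewrite hermC expr0 mul1r. Qed.

Lemma dot_gt0 (u : V) : u != 0 -> 0 < '[u, u].
Proof. exact: neq0_dnorm_gt0. Qed.

Lemma reflK (a : V) : a != 0 -> involutive (refl form a).
Proof.
move=> /dot_gt0/lt0r_neq0 aa0 v.
rewrite /refl /cartan linearBl linearZl_LR /= -addrA -opprD -scalerDl.
set c := (X in X *: _); have -> : c = 0 by rewrite /c; field.
by rewrite scale0r subr0.
Qed.

Lemma refl_self (a : V) : a != 0 -> refl form a a = - a.
Proof.
move=> /dot_gt0/lt0r_neq0 aa0.
have -> : refl form a a = a - 2 *: a by rewrite /refl /cartan mulfK.
by rewrite scaler_nat mulr2n opprD addrA subrr sub0r.
Qed.

Lemma dot_sum_gt0 (u : V) (s : seq V) :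
  0 < '[u, \sum_(b <- s) b] -> exists2 b, b \in s & 0 < '[u, b].
Proof.
rewrite linear_sumr => pos; apply/hasP/contraT; rewrite -all_predC => /allP neg.
suff : \sum_(b <- s) '[u, b] <= 0 by rewrite leNgt pos.
by rewrite big_seq sumr_le0 // => b /neg /=; rewrite -leNgt.
Qed.

End Form.

(** * Differences of roots and inverses in the Weyl group *)

Section RootSystem.
Variables (R : realFieldType) (V : vectType R) (form : {dot V for idfun}).
Local Notation "''[' u , v ]" := (form u%R v%R) : ring_scope.
Variables (Delta : {fset V}) (hDelta : reduced_root_system form Delta).

Lemma root_nz a : a \in Delta -> a != 0.
Proof. by apply: contraL => /eqP ->; case: hDelta. Qed.

Lemma root_dot_gt0 a : a \in Delta -> 0 < '[a, a].
Proof. by move=> /root_nz /(dot_gt0 form). Qed.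

Lemma root_opp a : a \in Delta -> - a \in Delta.
Proof.
by move=> aD; rewrite -(refl_self form (root_nz aD)) (root_refl hDelta).
Qed.

(* If both Cartan integers are at least 2, then Cauchy-Schwarz is an equality
   and the roots are proportional. *)
Lemma root_sub a b :
  a \in Delta -> b \in Delta -> 0 < '[a, b] -> a != b -> a - b \in Delta.
Proof.
move=> aD bD ab0 neq_ab.
have aa0 := root_dot_gt0 aD; have bb0 := root_dot_gt0 bD.
have refl_ab := root_refl hDelta aD bD; have refl_ba := root_refl hDelta bD aD.
have [m cm] := root_crystal hDelta aD bD.
have [n cn] := root_crystal hDelta bD aD.
have em : 2 * '[a, b] = m%:~R * '[a, a].
  by rewrite -cm /cartan dotC divfK // gt_eqF.
have en : 2 * '[a, b] = n%:~R * '[b, b].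
  by rewrite -cn /cartan divfK // gt_eqF.
have m0 : 0 < m by rewrite -(ltr0z R) -(pmulr_lgt0 _ aa0) -em; lra.
have n0 : 0 < n by rewrite -(ltr0z R) -(pmulr_lgt0 _ bb0) -en; lra.
(* A Cartan integer equal to 1 makes one of the two reflected roots [a - b] or [b - a]. *)
case: (eqVneq n 1) => [n1|nn1].
  by move: refl_ba; rewrite /refl cn n1 scale1r.
case: (eqVneq m 1) => [m1|mn1].
  by move: refl_ab; rewrite /refl cm m1 scale1r => /root_opp; rewrite opprB.
have m2 : 2 <= m%:~R :> R by rewrite -[2]/(2%:~R) ler_int; lia.
have n2 : 2 <= n%:~R :> R by rewrite -[2]/(2%:~R) ler_int; lia.
have leab : '[a, a] * '[b, b] <= '[a, b] ^+ 2.
  have h1 : '[a, a] <= '[a, b] by nra.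
  have h2 : '[b, b] <= '[a, b] by nra.
  by rewrite expr2 ler_pM // ltW.
(* The norm of [u] is ['[b, b] * ('[a, a] * '[b, b] - '[a, b] ^+ 2)], which [leab] makes
   nonpositive. *)
pose u := '[b, b] *: a - '[a, b] *: b.
have u0 : u = 0.
  apply/eqP; apply: contraT => /(dot_gt0 form); rewrite /u.
  rewrite linearBl !linearBr !linearZl_LR !linearZr_LR /= (dotC form b a).
  by move=> pos; exfalso; nra.
have ea : a = ('[a, b] / '[b, b]) *: b.
  apply: (scalerI (a := '[b, b])); first by rewrite gt_eqF.
  rewrite scalerA mulrCA divff ?mulr1 ?gt_eqF //.
  by apply/eqP; rewrite -subr_eq0 -/u u0.
have c0 : 0 < '[a, b] / '[b, b] by rewrite divr_gt0.
have := root_reduced hDelta bD (c := '[a, b] / '[b, b]).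
rewrite -ea => /(_ aD) [c1|c1]; last by move: c0; rewrite c1; lra.
by move: neq_ab; rewrite ea c1 scale1r eqxx.
Qed.

(** Reflections are involutions, so the reversed product is an inverse. It serves to pull a
    decomposition of [- w gamma] back to one of [gamma]. *)
Lemma weyl_group_inv w : weyl_group form Delta w ->
  {in Delta, forall a, w a \in Delta} /\
  exists u : 'End(V),
    [/\ cancel w u, cancel u w & {in Delta, forall a, u a \in Delta}].
Proof.
elim=> [|a {}w aD _ [wD [u [wK uK uD]]]].
  by split=> [b|]; [rewrite id_lfunE | exists \1%VF; split=> b; rewrite !id_lfunE].
have rK := reflK form (root_nz aD).
split=> [b bD|]; first by rewrite comp_lfunE lfunE /= (root_refl hDelta) // wD.
exists (u \o linfun (refl form a))%VF; split=> b.
- by rewrite !comp_lfunE !lfunE /= rK wK.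
- by rewrite !comp_lfunE !lfunE /= uK rK.
- by move=> bD; rewrite comp_lfunE lfunE uD //= (root_refl hDelta).
Qed.

(** * Positive systems and simple roots *)

Variables (P : {fset V}) (hP : positive_system form Delta P).

Lemma pos_root a : a \in P -> a \in Delta.
Proof. by case: hP => v [_ ->]; rewrite !inE => /andP[]. Qed.

Lemma pos_or_opp a : a \in Delta -> a \in P \/ - a \in P.
Proof.
case: hP => v [nz ->] aD; rewrite !inE /= aD root_opp //= linearNr oppr_gt0.
by case: (ltgtP '[v, a] 0) (nz _ aD); [right|left|].
Qed.

(** The functional defining [P] is positive on every summand, hence on the sum. *)
Lemma pos_sum_neq0 (s : seq V) : {subset s <= P} -> s != [::] -> \sum_(a <- s) a != 0.
Proof.
case: hP => v [_ eP] sP s0.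
suff : 0 < '[v, \sum_(a <- s) a].
  by apply: contraTneq => ->; rewrite linear0r ltxx.
have {}sP a : a \in s -> 0 < '[v, a] by move/sP; rewrite eP !inE => /andP[].
case: s s0 sP => // a s _ sP.
rewrite linear_sumr big_cons ltr_pwDl ?sP ?mem_head //.
by rewrite big_seq sumr_ge0 // => b bs; rewrite ltW // sP // in_cons bs orbT.
Qed.

Lemma pos_add_neq0 a b : a \in P -> b \in P -> a + b != 0.
Proof.
move=> aP bP; have := @pos_sum_neq0 [:: a; b].
by rewrite !big_cons big_nil addr0; apply=> // c; rewrite !inE => /orP[]/eqP->.
Qed.

Lemma pos_opp a : a \in P -> - a \notin P.
Proof. by move=> aP; apply/negP => /(pos_add_neq0 aP); rewrite subrr eqxx. Qed.

Lemma pos_add a b : a \in P -> b \in P -> a + b \in Delta -> a + b \in P.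
Proof.
case: hP => v [_ ->]; rewrite !inE /= linearDr => /andP[_ a0] /andP[_ b0] ->.
exact: addr_gt0.
Qed.

Lemma pos_opp_add a b : a \in P -> b \in P -> - (a + b) \notin P.
Proof.
move=> aP bP; apply/negP => abP.
have sP : {subset [:: a; b; - (a + b)] <= P}.
  by move=> c; rewrite !inE => /or3P[]/eqP->.
have := pos_sum_neq0 sP isT.
by rewrite !big_cons big_nil addr0 addrA subrr eqxx.
Qed.

Lemma simpleP a : reflect (a \in P /\ forall b c, b \in P -> c \in P -> a != b + c)
  (a \in simple_roots P).
Proof.
rewrite !inE; apply: (iffP andP) => -[aP ind]; split=> //.
  move=> b c bP cP; apply: contraNneq ind => ->.
  by apply/imfset2P; exists b => //; exists c.
by apply/imfset2P => -[b bP [c cP]]; apply/eqP/ind.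
Qed.

Lemma simple_pos a : a \in simple_roots P -> a \in P.
Proof. by case/simpleP. Qed.

Lemma not_simple a : a \in P -> a \notin simple_roots P ->
  exists b c, [/\ b \in P, c \in P & a = b + c].
Proof.
by rewrite !inE => -> /=; rewrite negbK => /imfset2P[b bP [c cP ->]]; exists b, c.
Qed.

(** Otherwise [a] has positive product with some summand [b], and [a - b], the nonempty sum of the
    others, is a root. If it is positive, it decomposes [a]; if negative, [b - a] and the other
    summands are positive roots with sum 0. *)
Lemma simple_not_sum a (s : seq V) : a \in simple_roots P -> {subset s <= P} ->
  (1 < size s)%N -> a != \sum_(b <- s) b.
Proof.
move=> /simpleP[aP ind] sP s2; apply/eqP => ea.
have [b bs ab0] : exists2 b, b \in s & 0 < '[a, b].
  by apply: dot_sum_gt0; rewrite -ea root_dot_gt0 // pos_root.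
have eab : a - b = \sum_(c <- rem b s) c.
  by rewrite ea (perm_big _ (perm_to_rem bs)) big_cons addrC addKr.
have ab_nz : a - b != 0.
  rewrite eab pos_sum_neq0 => [//|c /mem_rem/sP //|].
  by rewrite -size_eq0 size_rem // -lt0n -subn1 subn_gt0.
have abD : a - b \in Delta.
  by apply: root_sub => //; [exact: pos_root | exact/pos_root/sP | rewrite -subr_eq0].
have [abP|baP] := pos_or_opp abD.
  by have := ind b (a - b) (sP _ bs) abP; rewrite addrC subrK eqxx.
have := @pos_sum_neq0 (- (a - b) :: rem b s); rewrite big_cons -eab addNr eqxx.
move=> /(_ _ isT) H; apply: notF; apply: H.
by move=> c; rewrite inE => /predU1P[->//|/mem_rem/sP].
Qed.

(* Induction on the number of positive roots that are smaller for the linear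
   functional defining P. *)
Lemma pos_simple_comb a : a \in P ->
  exists c : V -> nat, a = \sum_(b <- simple_roots P) b *+ c b.
Proof.
have [v [_ eP]] := hP.
pose below x := [fset b in P | '[v, b] < '[v, x]]%fset.
have [n] := ubnP #|` below a|; elim: n a => // n IHn a; rewrite ltnS => le_n aP.
have [aS|/not_simple[//|b [c [bP cP ea]]]] := boolP (a \in simple_roots P).
  exists (fun b => (b == a)%N); rewrite (big_fsetD1 a) //= eqxx mulr1n big1_fset.
    by rewrite addr0.
  by move=> b; rewrite !inE => /andP[/negPf-> _].
have lt_below x y : x \in P -> '[v, x] < '[v, y] -> (#|` below x| < #|` below y|)%N.
  move=> xP lt_xy; apply/fproper_ltn_card; rewrite fproperE; apply/andP; split.
    by apply/fsubsetP => z; rewrite !inE => /andP[-> /lt_trans->].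
  by apply/fsubsetPn; exists x; rewrite !inE /= xP ?ltxx ?lt_xy.
have v_pos x : x \in P -> 0 < '[v, x] by rewrite eP !inE => /andP[].
have [|f ef] := IHn b _ bP.
  by apply: leq_trans le_n; apply: lt_below; rewrite // ea linearDr ltrDl v_pos.
have [|g eg] := IHn c _ cP.
  by apply: leq_trans le_n; apply: lt_below; rewrite // ea linearDr ltrDr v_pos.
exists (fun x => f x + g x)%N; rewrite ea {1}ef {1}eg -big_split /=.
by apply: eq_bigr => x _; rewrite mulrnDr.
Qed.

(** Listing simple roots with repetition lets an induction remove one summand at a time. *)
Lemma root_le_seq mu gamma : root_le (simple_roots P) mu gamma ->
  exists2 s : seq V, {subset s <= simple_roots P} & gamma = mu + \sum_(a <- s) a.
Proof.
case=> c e; exists (flatten [seq nseq (c a) a | a <- simple_roots P]).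
  by move=> a /flatten_mapP[b bS]; rewrite mem_nseq => /andP[_ /eqP->].
rewrite big_flatten big_map -[LHS](subrK mu) e addrC; congr (_ + _).
by apply: eq_bigr => a _; rewrite big_nseq iter_addr_0.
Qed.

(** * Degrees of positive roots and of iterated sums *)

Variables (D : int -> {fset V}) (hD : Zgrading Delta D)
  (hDP : compatible_grading form D P).

Lemma grading_uniq i j a : a \in D i -> a \in D j -> i = j.
Proof.
move=> ai aj; apply/eqP; apply: contraT => /(grading_disjoint hD).
by move=> /fdisjointP/(_ _ ai); rewrite aj.
Qed.

Lemma pos_degree a : a \in P -> exists2 i : int, 0 <= i & a \in D i.
Proof.
case: hDP => P0 [[v [_ eP0]] /(_ a)[aP _]] /aP[|[i i1 ai]].
  by rewrite eP0 !inE => /andP[aD0 _]; exists 0.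
by exists i => //; apply: le_trans i1.
Qed.

Lemma degree_pos (i : int) a : 1 <= i -> a \in D i -> a \in P.
Proof. by case: hDP => P0 [_ /(_ a)[_ H]] i1 ai; apply: H; right; exists i. Qed.

(* Since [mu - gamma] has positive norm, it has positive product with one of
   the summands, which can be added to [gamma] or removed from [mu]. *)
Lemma degree_add_simple (s : seq V) gamma mu i j : {subset s <= simple_roots P} ->
  gamma \in P -> gamma \in D i -> mu \in P -> mu \in D j ->
  mu = gamma + \sum_(a <- s) a -> i <= j /\ (i = j -> {subset s <= D 0}).
Proof.
have [n] := ubnP (size s).
elim: n s gamma mu i j => // n IHn s gamma mu i j lt_n sS gP gi mP mj emu.
have sP : {subset s <= P} by move=> a /sS /simple_pos.
have [s0|s_nz] := eqVneq s [::].
  move: emu; rewrite s0 big_nil addr0 => emu; rewrite emu in mj.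
  by rewrite (grading_uniq gi mj).
have [a as_ pos] : exists2 a, a \in s & 0 < '[mu - gamma, a].
  by apply: dot_sum_gt0; rewrite emu addrC addKr dot_gt0 // pos_sum_neq0.
have aP := sP _ as_; have [d d0 ad] := pos_degree aP.
have emu' : mu = gamma + a + \sum_(b <- rem a s) b.
  by rewrite emu (perm_big _ (perm_to_rem as_)) big_cons addrA.
have lt_rem : (size (rem a s) < n)%N.
  by rewrite size_rem // -ltnS prednK // lt0n size_eq0.
have remS : {subset rem a s <= simple_roots P} by move=> b /mem_rem /sS.
have s_rem b : b \in s -> b = a \/ b \in rem a s.
  by rewrite (perm_mem (perm_to_rem as_)) inE => /predU1P.
move: pos; rewrite linearBl /= subr_gt0 => pos.
have [ga_neg|ga_ge] := ltP '[gamma, a] 0.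
  have gaP : gamma + a \in P.
    apply: pos_add => //; rewrite -[a]opprK root_sub ?root_opp ?pos_root //.
      by rewrite linearNr oppr_gt0.
    by rewrite -addr_eq0 pos_add_neq0.
  have gaD := grading_add hD gi ad (pos_root gaP).
  have [le_ij eq_ij] := IHn _ _ _ _ _ lt_rem remS gaP gaD mP mj emu'.
  split=> [|ij]; first by rewrite (le_trans _ le_ij) // lerDl.
  (* Here [i + d <= j = i] with [d >= 0]. *)
  have d_eq0 : d = 0.
    by apply/le_anti; rewrite d0 andbT -(lerD2l i) addr0 [leRHS]ij.
  have /eq_ij rem0 : i + d = j by rewrite d_eq0 addr0.
  by move=> b /s_rem[->|/rem0 //]; rewrite -d_eq0.
(* Equality would make [gamma] and the remaining summands positive roots with sum 0. *)
have mu_neq : mu != a.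
  apply/eqP => emua; have gsP : {subset gamma :: rem a s <= P}.
    by move=> b; rewrite inE => /predU1P[->//|/remS /simple_pos].
  have /eqP[] := pos_sum_neq0 gsP isT; apply: (addIr a).
  by rewrite big_cons add0r addrAC -emu'.
have maD : mu - a \in Delta.
  by rewrite root_sub ?pos_root // (le_lt_trans ga_ge).
(* If [a - mu] were positive, [mu + (a - mu)] would decompose the simple root [a]. *)
have maP : mu - a \in P.
  have [//|amP] := pos_or_opp maD; have /simpleP[_ ind] := sS _ as_.
  by have := ind _ _ mP amP; rewrite opprB addrC subrK eqxx.
have [e e0 mae] := pos_degree maP.
have ej : j = e + d.
  apply: (grading_uniq mj); rewrite -[mu](subrK a).
  by apply: (grading_add hD mae ad); rewrite subrK pos_root.
have ema : mu - a = gamma + \sum_(b <- rem a s) b.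
  by apply: (addIr a); rewrite subrK emu' addrAC.
have [le_ij eq_ij] := IHn _ _ _ _ _ lt_rem remS gP gi maP mae ema.
split=> [|ij]; first by rewrite ej (le_trans le_ij) // lerDl.
have d_eq0 : d = 0.
  by apply/le_anti; rewrite d0 andbT -(lerD2l e) addr0 -ej -ij.
have /eq_ij rem0 : i = e by rewrite ij ej d_eq0 addr0.
by move=> b /s_rem[->|/rem0 //]; rewrite -d_eq0.
Qed.

Lemma root_le_addr gamma eta : eta \in P ->
  root_le (simple_roots P) gamma (gamma + eta).
Proof. by move=> /pos_simple_comb[c e]; exists c; rewrite addrC addKr. Qed.

Lemma sum_powS (I : {fset V}) k a : a \in sum_pow Delta I k.+2 ->
  exists b c, [/\ b \in I, c \in sum_pow Delta I k.+1 & a = b + c].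
Proof.
by rewrite inE => /andP[/imfset2P[b bI [c cI ->]] _]; exists b, c.
Qed.

(** The exponent of an iterated sum can thus be read off the degree: the closure of [I] has nothing
    in degree 0 and only [I] in degree 1. *)
Lemma sum_pow_degree (I : {fset V}) k a : (I `<=` D 1)%fset ->
  a \in sum_pow Delta I k.+1 -> a \in D k.+1.
Proof.
move=> /fsubsetP ID; elim: k a => [|k IHk] a aI; first exact: ID.
have [b [c [bI cI ea]]] := sum_powS aI.
have aD : a \in Delta by move: aI; rewrite inE => /andP[].
rewrite ea intS; apply: (grading_add hD); rewrite -?ea //.
  exact: ID.
exact: IHk.
Qed.

(** * The inversion set of [w] and maximal elements of [I] *)

Variables (I : {fset V}) (hI : lower_ideal (root_le (simple_roots P)) (D 1) I)
  (w : 'End(V)) (hw : is_w_min form Delta P I w).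

Let ID : (I `<=` D 1)%fset. Proof. by case: hI. Qed.
Let wD a : a \in Delta -> w a \in Delta.
Proof. by case: hw => /weyl_group_inv[H _] _; apply: H. Qed.

Lemma w_min_sum_pow a :
  a \in P -> - w a \in P -> exists k, a \in sum_pow Delta I k.+1.
Proof.
move=> aP waP; case: hw => _ /(_ a)[+ _]; rewrite !inE aP waP.
by case=> // -[//|k] _ ak; exists k.
Qed.

Lemma sum_pow_w_min k a :
  a \in sum_pow Delta I k.+1 -> a \in P /\ - w a \in P.
Proof.
move=> ak; have /(proj2 (proj2 hw a)) : sum_closure Delta I a by exists k.+1.
by rewrite !inE => /andP.
Qed.

Lemma w_min_degree1 a : a \in D 1 -> - w a \in P -> a \in I.
Proof.
move=> a1 waP; have [k ak] := w_min_sum_pow (degree_pos (lexx 1) a1) waP.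
have /eqP := grading_uniq a1 (sum_pow_degree ID ak).
by rewrite eqz_nat eqSS => /eqP k0; rewrite -k0 in ak.
Qed.

Lemma w_min_degree0 a : a \in P -> a \in D 0 -> w a \in P.
Proof.
move=> aP a0; have [//|waP] := pos_or_opp (wD (pos_root aP)).
have [k ak] := w_min_sum_pow aP waP.
by have /eqP := grading_uniq a0 (sum_pow_degree ID ak).
Qed.

Lemma degree_add_pos a b (i j : int) : a \in P -> b \in P -> a \in D i ->
  a + b \in D j -> exists2 e : int, 0 <= e & b \in D e /\ j = i + e.
Proof.
move=> aP bP ai abj; have [e e0 be] := pos_degree bP; exists e => //; split=> //.
apply: (grading_uniq abj); apply: (grading_add hD) => //.
by apply/(grading_cover hD); exists j.
Qed.

(* In [gamma + eta = i + z] with [i] in [I] and [z] in [I^k], some summand on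
   the left has positive product with a summand on the right, so the difference
   of the two is, up to sign, the root [gamma - i] or [eta - i]. It contradicts
   the closedness of the inversion set or of its complement, or the maximality
   of [gamma], unless [eta - i] is a positive root; then [z = gamma + (eta - i)]
   is a smaller instance. *)
Lemma maximal_add_notin_sum_pow gamma eta k :
  maximal_in (root_le (simple_roots P)) I gamma ->
  eta \in P -> w eta \in P -> gamma + eta \notin sum_pow Delta I k.+1.
Proof.
case=> gI gmax; have [gP wgP] := sum_pow_w_min (k := 0) gI.
have g1 := fsubsetP ID _ gI.
elim: k eta => [|k IHk] eta eP weP; apply/negP => gek.
  have := gmax _ gek (root_le_addr _ eP).
  by move/eqP; rewrite -subr_eq0 addrC addKr (negPf (root_nz (pos_root eP))).
have [i [z [iI zk e_gei]]] := sum_powS gek.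
have [iP wiP] := sum_pow_w_min (k := 0) iI; have [zP wzP] := sum_pow_w_min zk.
have i1 := fsubsetP ID _ iI.
(* Comparing degrees gives [eta] degree [k.+1]. *)
have [d d0 [ed]] := degree_add_pos gP eP g1 (sum_pow_degree ID gek).
rewrite intS => /addrI d_k.
have caseA : gamma - i \in Delta -> False.
  move=> giD; have ezg : z = eta + (gamma - i).
    by apply: (addrI i); rewrite -e_gei addrCA subrKC addrC.
  have [giP|igP] := pos_or_opp giD.
    have := g1; rewrite -{1}[gamma](subrKC i).
    case/(degree_add_pos iP giP i1) => e e0 [gie].
    rewrite -{1}[1]addr0 => /addrI e_0; rewrite -e_0 in gie.
    have := pos_opp_add weP (w_min_degree0 giP gie).
    by rewrite -linearD -ezg wzP.
  rewrite opprB in igP.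
  have := gmax i iI; rewrite -{1}[i](subrKC gamma) => /(_ (root_le_addr _ igP)) ig.
  by have := root_nz giD; rewrite ig subrr eqxx.
have caseB : eta - i \in Delta -> False.
  move=> eiD; have ezg : z = gamma + (eta - i).
    by apply: (addrI i); rewrite -e_gei addrCA subrKC.
  have [eiP|ieP] := pos_or_opp eiD.
    have weiP : w (eta - i) \in P.
      by rewrite linearB pos_add // -linearB wD.
    by have := IHk _ eiP weiP; rewrite -ezg zk.
  rewrite opprB in ieP.
  (* Since [i] has degree 1 and [eta] degree [k.+1], the positive root [i - eta] has degree 0, so
     [w] keeps it positive, and [w i] would be positive too. *)
  have := i1; rewrite -{1}[i](subrKC eta).
  case/(degree_add_pos eP ieP ed) => e e0 [iee].
  rewrite -d_k intS -{1}[1]addr0 -addrA => /addrI/esym/eqP.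
  rewrite paddr_eq0 // => /andP[_ /eqP e_0]; rewrite e_0 in iee.
  have := pos_opp_add weP (w_min_degree0 ieP iee).
  by rewrite -linearD subrKC wiP.
have pos : 0 < '[gamma + eta, i + z].
  rewrite -e_gei root_dot_gt0 // (grading_cover hD).
  by exists k.+2; apply: sum_pow_degree gek.
have sub_root a b : a \in P -> b \in P -> 0 < '[a, b] ->
    a = b \/ a - b \in Delta.
  move=> aP bP ab0; have [->|neq_ab] := eqVneq a b; [by left|right].
  by apply: root_sub => //; apply: pos_root.
have neq_ez : eta <> z by move=> ez; have := pos_opp weP; rewrite ez wzP.
have neq_ei : eta <> i by move=> ei; have := pos_opp weP; rewrite ei wiP.
(* These identities reduce the four products in [pos] to the two excluded differences. *)
have e_gi : gamma - i = - (eta - z).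
  by apply/eqP; rewrite -addr_eq0 addrACA e_gei -opprD subrr.
have e_gz : gamma - z = - (eta - i).
  by apply/eqP; rewrite -addr_eq0 addrACA e_gei -opprD [z + i]addrC subrr.
have ngi : '[gamma, i] <= 0.
  rewrite leNgt; apply/negP => /(sub_root _ _ gP iP)[gi|/caseA//].
  by apply: neq_ez; move: e_gei; rewrite gi => /addrI.
have nez : '[eta, z] <= 0.
  rewrite leNgt; apply/negP => /(sub_root _ _ eP zP)[//|/root_opp].
  by rewrite -e_gi => /caseA.
have ngz : '[gamma, z] <= 0.
  rewrite leNgt; apply/negP => /(sub_root _ _ gP zP)[gz|/root_opp].
    by apply: neq_ei; move: e_gei; rewrite gz addrC => /addIr.
  by rewrite e_gz opprK => /caseB.
have nei : '[eta, i] <= 0.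
  by rewrite leNgt; apply/negP => /(sub_root _ _ eP iP)[//|/caseB].
by move: pos; rewrite linearDl !linearDr /=; lra.
Qed.

Lemma maximal_simple gamma : maximal_in (root_le (simple_roots P)) I gamma ->
  - w gamma \in simple_roots P.
Proof.
move=> gmax; have gI := gmax.1; have g1 := fsubsetP ID _ gI.
have [gP wgP] := sum_pow_w_min (k := 0) gI.
apply: contraT => /(not_simple wgP)[b [c [bP cP e_bc]]].
have [_ [u [wK uK uD]]] := weyl_group_inv hw.1.
have e_g : gamma = - u b - u c.
  by rewrite -[LHS]wK -[w gamma]opprK e_bc linearN linearD opprD.
have deg_pos x : x \in P -> - u x \in P ->
    exists k, - u x \in sum_pow Delta I k.+1.
  by move=> xP uxP; apply: w_min_sum_pow; rewrite // linearN /= uK opprK.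
(* With [eta = u y], the sum [gamma + eta] is the inverted root [- u x], while [w eta = y] is
   positive. *)
have mixed x y : x \in P -> y \in P -> gamma = - u x - u y ->
    - u x \in P -> u y \in P -> False.
  move=> xP yP e_xy uxP uyP; have [k uxk] := deg_pos x xP uxP.
  have := maximal_add_notin_sum_pow k gmax uyP; rewrite uK => /(_ yP).
  by rewrite e_xy subrK uxk.
have uP x : x \in P -> - u x \in P \/ u x \in P.
  by move=> xP; apply/or_comm/pos_or_opp/uD/pos_root.
have [ubP|ubP] := uP b bP; have [ucP|ucP] := uP c cP.
(* Both summands are inverted, so their degrees [k.+1] and [l.+1] cannot add up to 1. *)
- have [k /(sum_pow_degree ID) ubk] := deg_pos b bP ubP.
  have := g1; rewrite e_g => /(degree_add_pos ubP ucP ubk)[e e0 [uce]].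
  have [l /(sum_pow_degree ID) ucl] := deg_pos c cP ucP.
  rewrite (grading_uniq uce ucl) -PoszD => /eqP.
  by rewrite eqz_nat addSn addnS.
- by case: (mixed b c).
- by case: (mixed c b); rewrite // addrC.
- by have := pos_opp_add ubP ucP; rewrite opprD -e_g gP.
Qed.

Lemma simple_maximal gamma : gamma \in D 1 -> - w gamma \in simple_roots P ->
  maximal_in (root_le (simple_roots P)) I gamma.
Proof.
move=> g1 wgS; have gI := w_min_degree1 g1 (simple_pos wgS).
split=> // mu muI /root_le_seq[s sS emu].
have [s0|s_nz] := eqVneq s [::]; first by rewrite emu s0 big_nil addr0.
have [muP wmuP] := sum_pow_w_min (k := 0) muI.
have [gP _] := sum_pow_w_min (k := 0) gI.
have [_ /(_ erefl) s0] :=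
  degree_add_simple sS gP g1 muP (fsubsetP ID _ muI) emu.
have wsP : {subset - w mu :: [seq w a | a <- s] <= P}.
  move=> b; rewrite inE => /predU1P[->//|/mapP[a as_ ->]].
  by apply: w_min_degree0; [apply/simple_pos/sS | apply: s0].
have size_ws : (1 < size (- w mu :: [seq w a | a <- s]))%N.
  by rewrite /= size_map ltnS lt0n size_eq0.
have /eqP[] := simple_not_sum wgS wsP size_ws.
by rewrite big_cons big_map -linear_sum emu linearD opprD subrK.
Qed.

End RootSystem.

Theorem theorem4p1 (R : realFieldType) (V : vectType R)
    (form : {dot V for idfun}) (Delta : {fset V})
    (hDelta : reduced_root_system form Delta)
    (hirr : irreducible_root_system form Delta)
    (D : int -> {fset V}) (hD : Zgrading Delta D)
    (P : {fset V}) (hP : positive_system form Delta P)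
    (hDP : compatible_grading form D P)
    (I : {fset V}) (hI : lower_ideal (root_le (simple_roots P)) (D 1) I)
    (w : 'End(V)) (hw : is_w_min form Delta P I w)
    (gamma : V) (hgamma : gamma \in D 1) :
  maximal_in (root_le (simple_roots P)) I gamma <->
  - w gamma \in simple_roots P.
Proof.
split; first exact: (maximal_simple hDelta hP hD hDP hI hw).
exact: (simple_maximal hDelta hP hD hDP hI hw hgamma).
Qed.
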